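(* Let $\phi:A\rightarrow K\{\tau\}$ be a Drinfeld module and let $v$ be a discrete valuation (place) of $K$. If $\phi$ has generic characteristic, assume $v$ does not lie over the valuation $v_\infty$ of $\mathrm{Frac}(A)$ associated to the closed point $\infty\in C$. Let $g\ge1$. Then for every $Q\in\mathbb{G}_a^g(K_v^{\mathrm{alg}})$ there exists a positive constant $C$ depending on $\phi$, $v$ and $Q$ such that for each $P\in\phi_{\mathrm{tor}}^g$, either $P=Q$ or $\lambda_v(P,Q)<C$.
   Context: Let $p$ be a prime, $q$ a power of $p$, $C$ a nonsingular projective curve over $\mathbb{F}_q$ with a fixed closed point $\infty$, and $A$ the ring of functions on $C$ regular away from $\infty$. Let $K$ be a field extension of $\mathbb{F}_q$ with a fixed ring morphism $i:A\to K$. Let $\tau$ be the Frobenius $x\mapsto x^q$ and $K\{\tau\}$ the ring of polynomials in $\tau$ with coefficients in $K$, multiplication being composition. A Drinfeld module is a ring morphism $\phi:A\to K\{\tau\}$, $a\mapsto\phi_a$, such that the coefficient of $\tau^0$ in $\phi_a$ is $i(a)$ for all $a$, and $\phi_a\neq i(a)\tau^0$ for some $a$. It has generic characteristic if $\ker i=0$ (then $i$ is assumed to extend to an embedding $\mathrm{Frac}(A)\hookrightarrow K$), finite characteristic otherwise. Here $K_v$ is the completion of $K$ at $v$ (with $v$ normalized to have value group $\mathbb{Z}$ on $K$), $K_v^{\mathrm{alg}}$ a fixed algebraic closure, and $v$ is extended to $K_v^{\mathrm{alg}}$ (value group $\mathbb{Q}$). The torsion $\phi_{\mathrm{tor}}$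 is the set of $x\in K_v^{\mathrm{alg}}$ with $\phi_a(x)=0$ for some nonzero $a\in A$, and $\phi_{\mathrm{tor}}^g$ is the set of $g$-tuples of such elements. For $P\in\mathbb{G}_a^g(K_v^{\mathrm{alg}})$, $\lambda_v(P,Q)=\min\{v(f(P)) : f\in I_Q\cap R_v[X_1,\dots,X_g]\}$, where $I_Q\subset K_v^{\mathrm{alg}}[X_1,\dots,X_g]$ is the vanishing ideal of the point $Q$ and $R_v$ is the valuation ring of $v$ in $K_v^{\mathrm{alg}}$. *)

(* Defs.v *)
From HB Require Import structures.
From mathcomp Require Import all_boot all_order all_algebra.
From mathcomp Require Import mpoly.
Set Implicit Arguments. Unset Strict Implicit. Unset Printing Implicit Defensive.
Import Order.TTheory GRing.Theory Num.Theory.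
Local Open Scope ring_scope.

(* A (Krull) valuation on a field, with values in an ordered group G; only
   its values on nonzero elements are meaningful (v 0 = +oo by convention,
   so the value stored at 0 is never used). *)
Definition is_valuation (F : fieldType) (G : realDomainType) (w : F -> G) :=
  (forall x y, x != 0 -> y != 0 -> w (x * y) = w x + w y) /\
  (forall x y, x != 0 -> y != 0 -> x + y != 0 ->
      Num.min (w x) (w y) <= w (x + y)).

Definition is_normalized_dval (F : fieldType) (w : F -> int) :=
  is_valuation w /\ exists x, x != 0 /\ w x = 1.

Definition same_val (F : fieldType) (w w' : F -> int) :=
  forall x, x != 0 -> w x = w' x.

(* F is an algebraic function field in one variable over Fq (embedded via
   kappa): F is a finite extension of Fq(t) for some t transcendental over Fq.
   This is the function field of the nonsingular projective curve C. *)
Definition is_function_field (Fq : finFieldType) (F : fieldType)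
    (kappa : {rmorphism Fq -> F}) :=
  exists t : F,
    (forall p : {poly Fq}, p != 0 -> (map_poly kappa p).[t] != 0) /\
    exists (n : nat) (b : 'I_n -> F), forall x : F,
      exists u d : 'I_n -> {poly Fq}, (forall k, d k != 0) /\
        x = \sum_(k < n)
              ((map_poly kappa (u k)).[t] / (map_poly kappa (d k)).[t]) * b k.

(* closed points of C = places of F/Fq = normalized discrete valuations of F
   trivial on Fq *)
Definition is_place (Fq : finFieldType) (F : fieldType)
    (kappa : {rmorphism Fq -> F}) (w : F -> int) :=
  is_normalized_dval w /\ forall c : Fq, c != 0 -> w (kappa c) = 0.

Definition regular_away (Fq : finFieldType) (F : fieldType)
    (kappa : {rmorphism Fq -> F}) (winf : F -> int) (x : F) :=
  forall w, is_place kappa w -> ~ same_val w winf -> x != 0 -> 0 <= w x.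

Definition lies_over (F K : fieldType) (v : K -> int) (j : {rmorphism F -> K})
    (winf : F -> int) :=
  exists e : nat, (0 < e)%N /\ forall x, x != 0 -> v (j x) = (e%:Z * winf x).

(* elements of K{tau} are represented by their coefficient polynomial
   f = sum_i f_i X^i  <->  sum_i f_i tau^i ; the product is composition *)
Definition skew_mul (K : fieldType) (q : nat) (f g : {poly K}) : {poly K} :=
  \sum_(i < size f) \sum_(j < size g) (f`_i * g`_j ^+ (q ^ i)) *: 'X^(i + j).

Definition is_drinfeld_module (A : comNzRingType) (K : fieldType) (q : nat)
    (i : {rmorphism A -> K}) (phi : A -> {poly K}) :=
  [/\ phi 1 = 1,
      forall a b, phi (a + b) = phi a + phi b,
      forall a b, phi (a * b) = skew_mul q (phi a) (phi b),
      forall a, (phi a)`_0 = i a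
    & exists a, phi a != (i a)%:P].

Definition tau_eval (K L : fieldType) (sigma : {rmorphism K -> L}) (q : nat)
    (f : {poly K}) (x : L) : L :=
  \sum_(j < size f) sigma f`_j * x ^+ (q ^ j).

Definition is_torsion (A : comNzRingType) (K L : fieldType)
    (sigma : {rmorphism K -> L}) (q : nat) (phi : A -> {poly K}) (x : L) :=
  exists a : A, a != 0 /\ tau_eval sigma q (phi a) x = 0.

Definition w_converges (L : fieldType) (w : L -> rat) (s : nat -> L) (l : L) :=
  forall M : rat, exists N, forall n, (N <= n)%N -> s n = l \/ M < w (s n - l).

Definition w_cauchy (L : fieldType) (w : L -> rat) (s : nat -> L) :=
  forall M : rat, exists N, forall m n, (N <= m)%N -> (N <= n)%N ->
    s m = s n \/ M < w (s m - s n).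

(* (L, w, sigma) is an algebraic closure of the completion K_v of (K, v),
   with w the extension of v: L is algebraically closed, w is a valuation on
   L extending v (through sigma), and L is algebraic over a subfield S
   (= K_v) which contains sigma(K) as a dense subfield and is complete. *)
Definition is_alg_closure_of_completion (K : fieldType) (v : K -> int)
    (L : closedFieldType) (sigma : {rmorphism K -> L}) (w : L -> rat) :=
  [/\ is_valuation w,
      forall x, x != 0 -> w (sigma x) = (v x)%:~R
    & exists S : pred L,
      [/\ (forall x, S (sigma x)) /\
          (forall x y, S x -> S y -> S (x - y) /\ S (x * y)) /\
          (forall x, S x -> S x^-1),
          forall s : nat -> L, (forall n, S (s n)) -> w_cauchy w s ->
             exists l, S l /\ w_converges w s l,
          forall l, S l -> exists s : nat -> K, w_converges w (sigma \o s) l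
        & forall x, exists p : {poly L},
             (p != 0 /\ (forall k, S p`_k) /\ root p x)]].

(* lambda_v(P,Q) = min { w(f(P)) : f in I_Q /\ f in R_v[X_1..X_g] },
   (w(0) = +oo).  "lambda_v(P,Q) < C" holds iff some admissible f has
   w(f(P)) < C (with f(P) <> 0). *)
Definition in_vanishing_ideal (L : comNzRingType) (g : nat) (Q : 'I_g -> L)
    (f : {mpoly L[g]}) := f.@[Q] = 0.

Definition integral_mpoly (L : fieldType) (w : L -> rat) (g : nat)
    (f : {mpoly L[g]}) := forall m, mcoeff m f != 0 -> 0 <= w (mcoeff m f).

Definition lambda_lt (L : fieldType) (w : L -> rat) (g : nat)
    (P Q : 'I_g -> L) (C : rat) :=
  exists f : {mpoly L[g]},
    [/\ in_vanishing_ideal Q f, integral_mpoly w f,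
        f.@[P] != 0 & w f.@[P] < C].

(* Main.v *)
Require Import Defs.
From HB Require Import structures.
From mathcomp Require Import all_boot all_order all_algebra.
From mathcomp Require Import all_solvable all_field.
From mathcomp Require Import mpoly.
From mathcomp Require Import ring lra zify.
From Stdlib Require Import Classical FunctionalExtensionality.
Set Implicit Arguments. Unset Strict Implicit. Unset Printing Implicit Defensive.
Import Order.TTheory GRing.Theory Num.Theory.
Local Open Scope ring_scope.

(* The problem is coordinatewise, and torsion points form a group, so it is
   enough to bound w on the nonzero torsion points. Since A has transcendence
   degree one over Fq, for any s in A every nonzero b in A divides c(s) for
   some nonzero polynomial c over Fq; so it is enough to find s such that no
   phi_{c(s)} has nonzero zeros in some fixed disc w > C. On a small disc phi_s
   is x |-> i(s) x up to terms of larger valuation.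
   - If w(i(s)) > 0 (or i(s) = 0) for some s <> 0, then phi_s strictly raises
     valuations on the disc, so phi_{c(s)}(x) is dominated by the lowest
     nonzero coefficient of c.
   - Otherwise w(i(s)) <= 0 for all s <> 0. If moreover w(i(t)) >= 0 for some t
     transcendental over Fq, then w(i(c(t))) = 0 for all c <> 0, and phi_{c(t)}
     preserves valuations on the disc.
   - The remaining possibility, i injective and w(i(t)) < 0, is excluded by the
     hypothesis on infinity: clearing leading coefficients, F = Frac(A), so v
     restricts to F, and the place of F below v has a pole at t, hence is
     infinity. *)

(** * Valuations, with [0] treated as having infinite value *)

Definition val_gt (F : fieldType) (G : realDomainType) (w : F -> G) (r : G)
  (x : F) := (x == 0) || (r < w x).

Definition val_ge (F : fieldType) (G : realDomainType) (w : F -> G) (r : G)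
  (x : F) := (x == 0) || (r <= w x).

Section Valuation.
Variables (F : fieldType) (G : realDomainType) (w : F -> G).
Hypothesis w_val : is_valuation w.
Implicit Types (x y : F) (r : G).

Lemma valM x y : x != 0 -> y != 0 -> w (x * y) = w x + w y.
Proof. by case: w_val => + _; apply. Qed.

Lemma val1 : w 1 = 0.
Proof.
have := valM (oner_neq0 F) (oner_neq0 F); rewrite mulr1.
by rewrite -[LHS]addr0 => /addrI.
Qed.

Lemma valX x n : x != 0 -> w (x ^+ n) = w x *+ n.
Proof.
move=> x0; elim: n => [|n IH]; first by rewrite expr0 mulr0n val1.
by rewrite exprS mulrS valM ?expf_neq0 // IH.
Qed.

Lemma val_root1 x n : (0 < n)%N -> x ^+ n = 1 -> w x = 0.
Proof.
move=> n0 xn1; have x0 : x != 0.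
  apply/eqP => x0; move: xn1; rewrite x0 expr0n gtn_eqF // => /eqP.
  by rewrite eq_sym oner_eq0.
apply/eqP; have := valX n x0; rewrite xn1 val1 => /esym/eqP.
by rewrite mulrn_eq0 gtn_eqF.
Qed.

Lemma valN x : w (- x) = w x.
Proof.
case: (eqVneq x 0) => [->|x0]; first by rewrite oppr0.
have wN1 : w (-1) = 0 by apply: (@val_root1 _ 2); rewrite ?sqrrN ?expr1n.
by rewrite -mulN1r valM ?oppr_eq0 ?oner_eq0 // wN1 add0r.
Qed.

Lemma valV x : x != 0 -> w x^-1 = - w x.
Proof.
move=> x0; apply/eqP; rewrite -addr_eq0 addrC -valM ?invr_eq0 //.
by rewrite divff // val1.
Qed.

Lemma valXz x n : x != 0 -> w (x ^ n) = w x *~ n.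
Proof.
move=> x0; case: n => n; first by rewrite -exprnP valX.
by rewrite NegzE -exprnN valV ?expf_neq0 // valX // mulrNz.
Qed.

Lemma val_gt0 r : val_gt w r 0. Proof. by rewrite /val_gt eqxx. Qed.

Lemma val_ge0 r : val_ge w r 0. Proof. by rewrite /val_ge eqxx. Qed.

Lemma val_gt_le r1 r2 x : r1 <= r2 -> val_gt w r2 x -> val_gt w r1 x.
Proof.
by move=> le12 /orP[h|h]; rewrite /val_gt ?h // (le_lt_trans le12 h) orbT.
Qed.

Lemma val_gtN r x : val_gt w r (- x) = val_gt w r x.
Proof. by rewrite /val_gt oppr_eq0 valN. Qed.

Lemma val_gtD r x y : val_gt w r x -> val_gt w r y -> val_gt w r (x + y).
Proof.
case: (eqVneq x 0) => [->|x0]; first by rewrite add0r.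
case: (eqVneq y 0) => [->|y0]; first by rewrite addr0.
rewrite /val_gt (negPf x0) (negPf y0) /= => rx ry.
case: eqVneq => //= xy0; have [_ /(_ _ _ x0 y0 xy0)] := w_val.
by apply: lt_le_trans; rewrite lt_min rx.
Qed.

Lemma val_geD r x y : val_ge w r x -> val_ge w r y -> val_ge w r (x + y).
Proof.
case: (eqVneq x 0) => [->|x0]; first by rewrite add0r.
case: (eqVneq y 0) => [->|y0]; first by rewrite addr0.
rewrite /val_ge (negPf x0) (negPf y0) /= => rx ry.
case: eqVneq => //= xy0; have [_ /(_ _ _ x0 y0 xy0)] := w_val.
by apply: le_trans; rewrite le_min rx.
Qed.

Lemma val_gtB r x y : val_gt w r x -> val_gt w r y -> val_gt w r (x - y).
Proof. by move=> hx hy; apply: val_gtD; rewrite ?val_gtN. Qed.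

Lemma val_gt_sum r (I : Type) (s : seq I) (P : pred I) (f : I -> F) :
  (forall i, P i -> val_gt w r (f i)) -> val_gt w r (\sum_(i <- s | P i) f i).
Proof. by move=> h; elim/big_ind: _ => //; [apply: val_gt0|apply: val_gtD]. Qed.

Lemma val_geM x y : val_ge w 0 x -> val_ge w 0 y -> val_ge w 0 (x * y).
Proof.
case: (eqVneq x 0) => [->|x0]; first by rewrite mul0r.
case: (eqVneq y 0) => [->|y0]; first by rewrite mulr0.
rewrite /val_ge mulf_eq0 (negPf x0) (negPf y0) /= => rx ry.
by rewrite valM // addr_ge0.
Qed.

Lemma val_ge_gtM r x y : val_ge w 0 x -> val_gt w r y -> val_gt w r (x * y).
Proof.
case: (eqVneq x 0) => [->|x0]; first by rewrite mul0r => _ _; apply: val_gt0.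
case: (eqVneq y 0) => [->|y0]; first by rewrite mulr0.
rewrite /val_ge /val_gt mulf_eq0 (negPf x0) (negPf y0) /= => rx ry.
by rewrite valM // (lt_le_trans ry) // lerDr.
Qed.

Lemma val_gt_self x : x != 0 -> val_gt w (w x) x = false.
Proof. by move=> x0; rewrite /val_gt (negPf x0) ltxx. Qed.

Lemma val_gt_addr x y : x != 0 -> val_gt w (w x) y -> x + y != 0.
Proof.
move=> x0 wy; apply/eqP => /eqP; rewrite addr_eq0 => /eqP xy.
by move: wy; rewrite -val_gtN -xy val_gt_self.
Qed.

Lemma val_gt_addr_val x y : x != 0 -> val_gt w (w x) y -> w (x + y) = w x.
Proof.
move=> x0 wy; have xy0 := val_gt_addr x0 wy.
apply/eqP; rewrite eq_le; apply/andP; split; rewrite leNgt; apply/negP => lt.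
  have := val_gt_self x0.
  by rewrite -{2}(addrK y x) val_gtB // /val_gt lt orbT.
case: (eqVneq y 0) => [y0|y0]; first by rewrite y0 addr0 ltxx in lt.
have [_ /(_ _ _ x0 y0 xy0)] := w_val.
move: wy; rewrite /val_gt (negPf y0) /= => wy.
by rewrite min_l ?(ltW wy) // leNgt lt.
Qed.

(* If [lead_coef p * x] had a pole, no cancellation could occur in the Horner
   scheme of [p]. *)
Lemma integral_lead_coef_mul (p : {poly F}) x :
  (forall k, val_ge w 0 p`_k) -> p != 0 -> root p x ->
  val_ge w 0 (lead_coef p * x).
Proof.
move=> p_int p0 px; case: (boolP (val_ge _ _ _)) => // /norP[cx0].
rewrite -ltNge => cx_lt; move: cx0; rewrite mulf_eq0 => /norP[c0 x0].
have wx_lt : w x < 0.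
  have := p_int (size p).-1; rewrite /val_ge -/(lead_coef p) (negPf c0) /= => h.
  by move: cx_lt; rewrite valM //; lra.
(* The Horner induction gives [p.[x]] a negative value for nonconstant [p]; as [x] is a root, [p] is
   constant, hence zero. *)
suff : (1 < size p)%N ==> (p.[x] != 0) && (w p.[x] < 0).
  rewrite (rootP px) eqxx /= implybF -leqNgt => /size1_polyC pC.
  by move: px p0; rewrite pC rootC polyC_eq0 => ->.
elim/poly_ind: p p_int p0 c0 cx_lt {px} => [|p c IH] p_int; first by rewrite eqxx.
move=> pc0; have c_int : val_ge w 0 c.
  by have := p_int 0%N; rewrite coefD coefMX coefC add0r.
have p_int' k : val_ge w 0 p`_k.
  by have := p_int k.+1; rewrite coefD coefMX coefC addr0.
case: (eqVneq p 0) => [->|p0]; first by rewrite mul0r add0r size_polyC ltnNge leq_b1.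
have sz : (size c%:P < size (p * 'X)%R)%N.
  by rewrite size_mulX // size_polyC ltnS (leq_trans (leq_b1 _)) // size_poly_gt0.
rewrite lead_coefDl // lead_coefMX => c0 cx_lt.
have px0 : p.[x] * x != 0 /\ w (p.[x] * x) < 0.
  have /implyP := IH p_int' p0 c0 cx_lt.
  case: ltnP => [_ /(_ isT)/andP[px0 px_lt]|/size1_polyC pE _].
    by rewrite mulf_neq0 // valM //; split=> //; lra.
  move: c0 cx_lt; rewrite pE lead_coefC hornerC => c0 cx_lt.
  by rewrite mulf_neq0.
rewrite hornerMXaddC; apply/implyP => _; case: px0 => px0 px_lt.
have gt : val_gt w (w (p.[x] * x)) c.
  case/orP: c_int => [/eqP->|c_ge]; first exact: val_gt0.
  by rewrite /val_gt (lt_le_trans px_lt c_ge) orbT.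
by rewrite (val_gt_addr_val px0 gt) px_lt (val_gt_addr px0 gt).
Qed.

End Valuation.

(** * Fractions and extension of morphisms to them *)

Lemma rmorph_frac_extend (A : comNzRingType) (F K : fieldType)
    (iota : {rmorphism A -> F}) (i : {rmorphism A -> K}) :
  injective iota -> injective i ->
  (forall x : F, exists a b, b != 0 /\ x * iota b = iota a) ->
  exists j : {rmorphism F -> K}, forall a, j (iota a) = i a.
Proof.
move=> iota_inj i_inj frac.
have iota0 b : b != 0 -> iota b != 0.
  by apply: contra => /eqP h; apply/eqP/iota_inj; rewrite h rmorph0.
have i0 b : b != 0 -> i b != 0.
  by apply: contra => /eqP h; apply/eqP/i_inj; rewrite h rmorph0.
have exP x : exists ab : A * A, (ab.2 != 0) && (x * iota ab.2 == iota ab.1).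
  by have [a [b [b0 h]]] := frac x; exists (a, b); rewrite b0 h eqxx.
pose j x := i (xchoose (exP x)).1 / i (xchoose (exP x)).2.
(* Independence of the chosen fraction: each ring law can then be checked on convenient numerators
   and denominators. *)
have jE x a b : b != 0 -> x * iota b = iota a -> j x = i a / i b.
  move=> b0 xb; rewrite /j; case: (xchoose _) (xchooseP (exP x)) => c d /=.
  case/andP => d0 /eqP xd; apply/eqP; rewrite eqr_div ?i0 //.
  apply/eqP; rewrite -!rmorphM; congr (i _); apply: iota_inj.
  by rewrite !rmorphM -xb -xd; ring.
have jadd : zmod_morphism j.
  move=> x y; have [a [b [b0 xb]]] := frac x; have [c [d [d0 yd]]] := frac y.
  have bd0 : b * d != 0.
    apply/eqP => /(congr1 iota)/eqP.
    by rewrite rmorphM rmorph0 mulf_eq0 !(negPf (iota0 _ _)).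
  rewrite (jE _ _ _ b0 xb) (jE _ _ _ d0 yd) (jE (x - y) (a * d - c * b) (b * d)) //.
    by rewrite rmorphB !rmorphM; field; rewrite !i0.
  by rewrite rmorphB !rmorphM -xb -yd; ring.
have jmul : monoid_morphism j.
  split.
    by rewrite (jE 1 1 1) ?oner_eq0 ?mul1r // rmorph1 divr1.
  move=> x y; have [a [b [b0 xb]]] := frac x; have [c [d [d0 yd]]] := frac y.
  have bd0 : b * d != 0.
    apply/eqP => /(congr1 iota)/eqP.
    by rewrite rmorphM rmorph0 mulf_eq0 !(negPf (iota0 _ _)).
  rewrite (jE _ _ _ b0 xb) (jE _ _ _ d0 yd) (jE (x * y) (a * c) (b * d)) //.
    by rewrite !rmorphM; field; rewrite !i0.
  by rewrite !rmorphM -xb -yd; ring.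
pose jZ := GRing.isZmodMorphism.Build F K j jadd.
pose jM := GRing.isMonoidMorphism.Build F K j jmul.
exists (HB.pack_for {rmorphism F -> K} j jZ jM) => a /=.
by rewrite (jE _ a 1) ?oner_eq0 ?rmorph1 ?mulr1 ?divr1.
Qed.

Lemma fraction_quotient (R : idomainType) (x : {fraction R}) :
  exists a b, b != 0 /\ x * FracField.tofrac b = FracField.tofrac a.
Proof.
elim/quotW: x => x; exists (frac x).1, (frac x).2.
have x0 : (frac x).2 != 0 by apply: denom_ratioP.
split=> //.
unlock FracField.tofrac; rewrite -[LHS]FracField.pi_mul; apply/eqmodP.
rewrite /= FracField.equivfE /FracField.mulf !numden_Ratio ?mulr1 ?oner_eq0 //.
by rewrite mulrC.
Qed.

Lemma fraction_common_denom (R : idomainType) (p : {poly {fraction R}}) :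
  exists (d : R) (P : {poly R}), d != 0 /\
    FracField.tofrac d *: p = map_poly (@FracField.tofrac R) P.
Proof.
elim/poly_ind: p => [|p c [d [P [d0 dP]]]].
  by exists 1, 0; rewrite oner_eq0 scaler0 rmorph0.
have [a [b [b0 cb]]] := fraction_quotient c.
exists (d * b), (P * (b *: 'X) + (d * a)%:P); split; first exact: mulf_neq0.
rewrite rmorphD rmorphM /= map_polyZ map_polyX map_polyC /= -dP !tofracM -cb.
by rewrite scalerDr -!mul_polyC !polyCM; ring.
Qed.

(** * Algebraic dependence in a function field of one variable *)

(** The [n + 1] powers of [y] up to [y ^+ n] have coordinate rows of length [n]; a nontrivial linear
    relation between these rows gives the coefficients of a polynomial killing [y]. *)
Lemma algebraicOver_finite_span (k F : fieldType) (e : {rmorphism k -> F})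
    (n : nat) (b : 'I_n -> F) :
  (forall x, exists c : 'I_n -> k, x = \sum_(l < n) e (c l) * b l) ->
  forall y, algebraicOver e y.
Proof.
move=> span y.
have [c cE] : exists c : 'I_n.+1 -> 'I_n -> k,
    forall m : 'I_n.+1, y ^+ m = \sum_(l < n) e (c m l) * b l.
  by have [c cE] := fin_all_exists (fun m : 'I_n.+1 => span (y ^+ m)); exists c.
pose C := \matrix_(m < n.+1, l < n) c m l.
have /rowV0Pn [u] : kermx C != 0.
  by rewrite -mxrank_eq0 mxrank_ker subn_eq0 -ltnNge ltnS rank_leq_col.
move=> /sub_kermxP uC u0.
exists (\poly_(m < n.+1) u 0 (inord m)).
  apply: contra u0 => /eqP p0; apply/eqP/rowP => m; rewrite mxE.
  have := congr1 (fun p : {poly k} => p`_m) p0.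
  by rewrite coef_poly coef0 ltn_ord inord_val.
apply/rootP; rewrite poly_def rmorph_sum horner_sum /=.
under eq_bigr => m _ do
  rewrite map_polyZ map_polyXn hornerZ hornerXn inord_val cE mulr_sumr.
rewrite exchange_big /=; apply: big1 => l _.
have /rowP/(_ l) := uC; rewrite !mxE => /(congr1 e); rewrite rmorph0 rmorph_sum.
move=> h; transitivity ((\sum_m e (u 0 m * C m l)) * b l).
  by rewrite mulr_suml; apply: eq_bigr => m _; rewrite mxE rmorphM mulrA.
by rewrite h mul0r.
Qed.

(** Packaged as a ring morphism so that [map_poly (evp f x)] can specialize the inner variable of a
    two-variable polynomial. *)
Definition evp (k R : comNzRingType) (f : {rmorphism k -> R}) (x : R) :
  {rmorphism {poly k} -> R} := horner_eval x \o map_poly f.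

Lemma evpE (k R : comNzRingType) (f : {rmorphism k -> R}) (x : R) p :
  evp f x p = (map_poly f p).[x].
Proof. by []. Qed.

Lemma evpC (k R : comNzRingType) (f : {rmorphism k -> R}) (x : R) c :
  evp f x c%:P = f c.
Proof. by rewrite evpE map_polyC hornerC. Qed.

Lemma evpX (k R : comNzRingType) (f : {rmorphism k -> R}) (x : R) :
  evp f x 'X = x.
Proof. by rewrite evpE map_polyX hornerX. Qed.

(** Lets an algebraic relation between [x] and [y] be read with their roles exchanged. *)
Lemma evp_swap (k R : comNzRingType) (f : {rmorphism k -> R}) (x y : R) P :
  (map_poly (evp f x) (swapXY P)).[y] = (map_poly (evp f y) P).[x].
Proof.
have evE z Q : map_poly (evp f z) Q =
    map_poly (horner_eval z) (map_poly (map_poly f) Q).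
  by rewrite -map_poly_comp.
have ev2 z t (Q : {poly {poly R}}) : (map_poly (horner_eval z) Q).[t] = Q.[t%:P].[z].
  by rewrite -{1}(hornerC t z) -/(horner_eval z t%:P) horner_map.
by rewrite !evE !ev2 -swapXY_map horner2_swapXY.
Qed.

(** Either [x] is algebraic over [Fq], which gives a relation free of [y], or [F] is algebraic over
    the copy of [Fq(x)] in it, and denominators can be cleared. *)
Lemma function_field_algebraic (Fq : finFieldType) (F : fieldType)
    (kappa : {rmorphism Fq -> F}) (x y : F) :
  is_function_field kappa ->
  exists2 P : {poly {poly Fq}}, P != 0 & root (map_poly (evp kappa x) P) y.
Proof.
pose k := {fraction {poly Fq}}; pose tof := @FracField.tofrac {poly Fq}.
move=> [T [T_tr [n [b b_span]]]].
have [x_alg|x_tr] := classic (exists2 p, p != 0 & evp kappa x p = 0).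
  have [p p0 px] := x_alg; exists p%:P; first by rewrite polyC_eq0.
  by rewrite /root map_polyC hornerC; apply/eqP.
have evp_inj z : (forall p, p != 0 -> evp kappa z p != 0) -> injective (evp kappa z).
  move=> h p q /eqP; rewrite -subr_eq0 -rmorphB => pq; apply/eqP.
  by rewrite -subr_eq0; apply: contraLR pq => /h.
have ext z : (forall p, p != 0 -> evp kappa z p != 0) ->
    exists j : {rmorphism k -> F}, forall p, j (tof p) = evp kappa z p.
  move=> h; apply: rmorph_frac_extend; [|exact: evp_inj|exact: fraction_quotient].
  by move=> p q /eqP; rewrite tofrac_eq => /eqP.
have [jT jTE] := ext T T_tr.
have [jx jxE] : exists j : {rmorphism k -> F}, forall p, j (tof p) = evp kappa x p.
  apply: ext => p p0; apply: contra_notN x_tr => /eqP px; by exists p.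
have algT : forall z, algebraicOver jT z.
  apply: (algebraicOver_finite_span (b := b)) => z.
  have [u [d [_ ->]]] := b_span z; exists (fun l => tof (u l) / tof (d l)).
  by apply: eq_bigr => l _; rewrite fmorph_div !jTE.
have clear (j : {rmorphism k -> F}) z t : (forall p, j (tof p) = evp kappa z p) ->
    algebraicOver j t ->
    exists2 P : {poly {poly Fq}}, P != 0 & root (map_poly (evp kappa z) P) t.
  move=> jE [p p0 /rootP pt]; have [d [P [d0 dP]]] := fraction_common_denom p.
  exists P.
    apply/eqP => P0; move/eqP: dP.
    by rewrite P0 rmorph0 scaler_eq0 tofrac_eq0 (negPf d0) (negPf p0).
  have <- : map_poly j (map_poly tof P) = map_poly (evp kappa z) P.
    by rewrite -map_poly_comp; apply: eq_map_poly => q /=; rewrite jE.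
  by apply/rootP; rewrite -dP map_polyZ hornerZ pt mulr0.
apply: (clear jx x y jxE).
(* Exchange: [x] is algebraic over [Fq(T)], and the same relation, swapped, makes [T] algebraic over
   [Fq(x)]. *)
have algxT : algebraicOver jx T.
  have [P P0 PT] := clear jT T x jTE (algT x).
  exists (map_poly tof (swapXY P)).
    rewrite map_poly_eq0_id0 ?swapXY_eq0 // tofrac_eq0.
    by rewrite lead_coef_eq0 swapXY_eq0.
  rewrite -map_poly_comp (@eq_map_poly _ _ _ (evp kappa x)) ?/root ?evp_swap //.
have algxevp (p : {poly Fq}) : integralOver jx (evp kappa T p).
  apply: integral_horner; last exact/integral_algebraic.
  apply/integral_poly => l; rewrite coef_map /=.
  have -> : kappa p`_l = jx (tof (p`_l)%:P) by rewrite jxE evpC.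
  exact: integral_id.
(* Transitivity: [y] is a root of a polynomial over [Fq(T)], whose coefficients are algebraic over
   [Fq(x)]; over a field, integral and algebraic agree. *)
have [p p0 py] := algT y; apply/integral_algebraic.
apply: (integral_root (p := map_poly jT p)) => //; first by rewrite map_poly_eq0.
apply/integral_poly => l; rewrite coef_map /=.
have [c [d [d0 h]]] := fraction_quotient p`_l.
have tofd0 : tof d != 0 by rewrite tofrac_eq0.
have -> : p`_l = tof c / tof d by apply: (canRL (mulfK tofd0)).
by rewrite fmorph_div; apply: integral_div; rewrite jTE.
Qed.

(** * Normalization of integer-valued valuations; values of finite constants *)

Lemma least_nat (P : nat -> Prop) :
  (exists n, P n) -> exists2 n, P n & forall m, P m -> (n <= m)%N.
Proof.
case=> n; elim/ltn_ind: n => n IH Pn.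
have [[m [Pm ltmn]]|min] := classic (exists m, P m /\ (m < n)%N); first exact: IH Pm.
exists n => // m Pm; rewrite leqNgt; apply/negP => ltmn; apply: min; by exists m.
Qed.

(** The values of [u] form a nonzero subgroup of the integers, generated by its least positive
    element [e]. *)
Lemma val_normalize (F : fieldType) (u : F -> int) (x0 : F) :
  is_valuation u -> x0 != 0 -> u x0 != 0 ->
  exists (e : nat) (u' : F -> int),
    [/\ (0 < e)%N, is_normalized_dval u' & forall x, x != 0 -> u x = e%:Z * u' x].
Proof.
move=> u_val x00 ux00.
have ex : exists n : nat, (0 < n)%N /\ exists y, y != 0 /\ u y = n%:Z.
  exists `|u x0|%N; split; first by rewrite absz_gt0.
  have [pos|neg] := leP 0 (u x0); first by exists x0; rewrite gez0_abs.
  exists x0^-1; rewrite invr_eq0 valV //; split=> //.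
  by rewrite ltz0_abs.
have [e [e0 [y [y0 uy]]] e_min] := least_nat ex.
have dvd x : x != 0 -> u x = e%:Z * (u x %/ e%:Z)%Z.
  move=> x00'; have := divz_eq (u x) e%:Z; set r := (u x %% e)%Z => ux.
  suff r0 : r = 0 by rewrite {1}ux r0 addr0 mulrC.
  have r_ge0 : 0 <= r by apply: modz_ge0; rewrite -lt0n in e0 *; case: (e) e0.
  have r_lt : r < e%:Z by apply: ltz_pmod; rewrite ltz_nat.
  apply/eqP; apply/negPn/negP => rn0.
  (* A nonzero remainder would be a positive value below [e], attained at [x] times a power of
     [y]. *)
  have : (e <= `|r|)%N; last by lia.
  apply: e_min; split; first by rewrite absz_gt0.
  exists (x * y ^ (- (u x %/ e%:Z)%Z)); split; first by rewrite mulf_neq0 // expfz_neq0.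
  rewrite valM // ?expfz_neq0 // valXz // uy gez0_abs // {1}ux.
  by rewrite -mulrzl mulrNz intz; ring.
have e0z : e%:Z != 0 by lia.
exists e, (fun x => (u x %/ e%:Z)%Z); split=> //.
split; last by exists y; rewrite uy divzz e0z.
have [uM uD] := u_val.
split=> [a b a0 b0|a b a0 b0 ab0].
  by apply: (mulfI e0z); rewrite -dvd ?mulf_neq0 // mulrDr -!dvd // uM.
have ez : 0 < e%:Z :> int by lia.
rewrite -(ler_pM2l ez) minr_pMr ?(ltW ez) //.
by rewrite -(dvd a) // -(dvd b) // -(dvd (a + b)) //; apply: uD.
Qed.

(** Nonzero elements of [Fq] are roots of unity, and an ordered group has no torsion. *)
Lemma val_finField (Fq : finFieldType) (F : fieldType) (G : realDomainType)
    (u : F -> G) (f : {rmorphism Fq -> F}) (c : Fq) :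
  is_valuation u -> c != 0 -> u (f c) = 0.
Proof.
move=> u_val c0; have q1 := finNzRing_gt1 Fq.
apply: (@val_root1 _ _ u u_val _ (#|Fq|.-1)); first by rewrite -ltnS prednK // ltnW.
rewrite -rmorphXn; apply: (mulfI (x := f c)); first by rewrite fmorph_eq0.
by rewrite mulr1 -rmorphM -exprS prednK ?expf_card // ltnW.
Qed.

(** * The ring [A] of functions regular away from infinity *)

Section Curve.
Variables (Fq : finFieldType) (F : fieldType) (kappa : {rmorphism Fq -> F}).
Variables (winf : F -> int) (A : comNzRingType) (iota : {rmorphism A -> F}).
Hypothesis F_ff : is_function_field kappa.
Hypothesis iota_inj : injective iota.
Hypothesis A_reg :
  forall x : F, (exists a, iota a = x) <-> regular_away kappa winf x.

Lemma iota_eq0 a : (iota a == 0) = (a == 0).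
Proof. by rewrite -(inj_eq iota_inj) rmorph0. Qed.

Lemma coord_ring_mulf_eq0 (a b : A) : (a * b == 0) = (a == 0) || (b == 0).
Proof. by rewrite -!iota_eq0 rmorphM mulf_eq0. Qed.

(** Constants have value 0 at every place, so they are regular and come from [A]. *)
Lemma coord_ring_constants :
  exists cst : {rmorphism Fq -> A}, forall c, iota (cst c) = kappa c.
Proof.
have exP c : exists a, iota a == kappa c.
  have [|a ha] := (A_reg (kappa c)).2; last by exists a; rewrite ha.
  move=> u [_ u0] _ kc0; rewrite u0 //.
  by apply: contra kc0 => /eqP ->; rewrite rmorph0.
pose j c := xchoose (exP c).
have jE c : iota (j c) = kappa c by apply/eqP/(xchooseP (exP c)).
have jadd : zmod_morphism j.
  by move=> x y; apply: iota_inj; rewrite rmorphB !jE rmorphB.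
have jmul : monoid_morphism j.
  by split=> [|x y]; apply: iota_inj; rewrite ?rmorphM ?jE ?rmorph1 ?rmorphM.
pose jZ := GRing.isZmodMorphism.Build Fq A j jadd.
pose jM := GRing.isMonoidMorphism.Build Fq A j jmul.
by exists (HB.pack_for {rmorphism Fq -> A} j jZ jM).
Qed.

Variable cst : {rmorphism Fq -> A}.
Hypothesis iota_cst : forall c, iota (cst c) = kappa c.

Lemma iota_evp s p : iota (evp cst s p) = evp kappa (iota s) p.
Proof.
rewrite !evpE -horner_map -map_poly_comp; congr _.[_].
by apply: eq_map_poly => c /=; rewrite iota_cst.
Qed.

(* [A] has transcendence degree one, so [s] and [b] are algebraically related;
   the relation can be chosen with nonzero constant coefficient in [b]. *)
Lemma coord_ring_divides (s b : A) : b != 0 ->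
  exists2 c, c != 0 & exists b', evp cst s c = b * b'.
Proof.
move=> b0; have [P P0 Pb] := function_field_algebraic (iota s) (iota b) F_ff.
have {Pb} : (map_poly (evp cst s) P).[b] = 0.
  apply: iota_inj; rewrite rmorph0 -horner_map -(rootP Pb) -map_poly_comp.
  by congr _.[_]; apply: eq_map_poly => p /=; rewrite iota_evp.
elim/poly_ind: P P0 => [|P c IH]; first by rewrite eqxx.
have -> : map_poly (evp cst s) (P * 'X + c%:P) =
    map_poly (evp cst s) P * 'X + (evp cst s c)%:P.
  by rewrite rmorphD rmorphM /= map_polyX map_polyC.
rewrite hornerMXaddC => Pc0 rel.
have [c0|c0] := eqVneq c 0; last first.
  exists c => //; exists (- (map_poly (evp cst s) P).[b]).
  by apply/eqP; rewrite mulrN -addr_eq0 addrC mulrC rel.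
(* When the constant coefficient vanishes, one factor [b] is cancelled and the induction
   continues. *)
move: rel Pc0; rewrite c0 (rmorph0 (evp cst s)) !addr0 => /eqP.
rewrite coord_ring_mulf_eq0.
rewrite (negPf b0) orbF => /eqP rel PX0; apply: IH => //.
by apply: contra PX0 => /eqP ->; rewrite mul0r.
Qed.

(** The leading coefficient of an equation of [x] over [Fq[t]], times [x], has no pole where the
    coefficients have none, so it lies in [A]; transcendence of [t] makes that leading coefficient a
    nonzero denominator. *)
Lemma coord_ring_frac (t : A) (x : F) :
  (forall p, p != 0 -> evp cst t p != 0) ->
  exists a b, b != 0 /\ x * iota b = iota a.
Proof.
move=> t_tr; have [P P0 Px] := function_field_algebraic (iota t) x F_ff.
pose p := map_poly (evp kappa (iota t)) P.
have lead0 : evp kappa (iota t) (lead_coef P) != 0.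
  by rewrite -iota_evp iota_eq0 t_tr ?lead_coef_eq0.
have leadE : lead_coef p = iota (evp cst t (lead_coef P)).
  by rewrite lead_coef_map_eq // iota_evp.
have p0 : p != 0 by rewrite -lead_coef_eq0 leadE iota_evp.
have [|a ha] := (A_reg (lead_coef p * x)).2.
  move=> u u_place u_winf cx0; have [[u_val _] _] := u_place.
  suff : val_ge u 0 (lead_coef p * x) by rewrite /val_ge (negPf cx0).
  apply: integral_lead_coef_mul => // k.
  have -> : p`_k = iota (evp cst t P`_k) by rewrite iota_evp coef_map.
  rewrite /val_ge; have [//|pk0] := eqVneq.
  by apply: ((A_reg _).1 (ex_intro _ _ erefl) u).
exists a, (evp cst t (lead_coef P)); split; last by rewrite ha leadE mulrC.
by apply: t_tr; rewrite lead_coef_eq0.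
Qed.

Lemma coord_ring_lies_over (K : fieldType) (i : {rmorphism A -> K})
    (v : K -> int) (t : A) :
  is_valuation v -> injective i ->
  (forall p, p != 0 -> evp cst t p != 0) -> v (i t) < 0 ->
  exists j : {rmorphism F -> K},
    (forall a, j (iota a) = i a) /\ lies_over v j winf.
Proof.
move=> v_val i_inj t_tr vt_lt.
have [j jE] := rmorph_frac_extend iota_inj i_inj (fun x => coord_ring_frac x t_tr).
exists j; split=> //.
have t0 : iota t != 0.
  by rewrite iota_eq0; rewrite -(evpX cst t) t_tr ?polyX_eq0.
pose u x := v (j x).
have u_val : is_valuation u.
  have [vM vD] := v_val; split=> [x y x0 y0|x y x0 y0 xy0]; rewrite /u.
    by rewrite rmorphM vM ?fmorph_eq0.
  by rewrite rmorphD vD -?rmorphD ?fmorph_eq0.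
have ut_lt : u (iota t) < 0 by rewrite /u jE.
have ut0 : u (iota t) != 0 by rewrite lt_eqF.
(* The pole at [t] makes [u] nontrivial; [e] is the ramification index of [v] over the place below
   it. At any place other than infinity [t] would be regular. *)
have [e [u' [e0 u'_norm uE]]] := val_normalize u_val t0 ut0.
have u'_place : is_place kappa u'.
  by split=> // c c0; case: u'_norm => u'_val _; apply: val_finField.
have same : same_val u' winf.
  apply: NNPP => nsame.
  have := (A_reg (iota t)).1 (ex_intro _ t erefl) u' u'_place nsame t0.
  by move: ut_lt; rewrite uE // pmulr_rlt0 ?ltz_nat // ltNge => /negP.
by exists e; split=> // x x0; rewrite -same // -uE.
Qed.

End Curve.

(** * Twisted polynomials and their additive action *)

(** The product of the two top terms is nonzero and alone in its degree, so degrees in tau add up;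
    sizes exceed degrees by one. *)
Lemma size_skew_mul (K : fieldType) (q : nat) (f g : {poly K}) :
  f != 0 -> g != 0 -> size (skew_mul q f g) = (size f + size g).-1.
Proof.
move=> f0 g0; have sf := polySpred f0; have sg := polySpred g0.
have lf : f`_(size f).-1 != 0 by rewrite -/(lead_coef f) lead_coef_eq0.
have lg : g`_(size g).-1 != 0 by rewrite -/(lead_coef g) lead_coef_eq0.
move: (size f).-1 (size g).-1 sf sg lf lg => n m sf sg lf lg.
rewrite /skew_mul sf sg big_ord_recr /= [X in _ + X]big_ord_recr /= addrA.
have sz_lead : size ((f`_n * g`_m ^+ (q ^ n)) *: 'X^(n + m)) = (n + m).+1.
  by rewrite size_scale ?size_polyXn // mulf_neq0 ?expf_neq0.
have sz_term (c : K) k l : (k <= l)%N -> (size (c *: 'X^k) <= l.+1)%N.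
  by move=> kl; apply: leq_trans (size_scale_leq _ _) _; rewrite size_polyXn.
rewrite addrC size_polyDl sz_lead ?addSn ?addnS // ltnS.
apply: leq_trans (size_polyD _ _) _; rewrite geq_max; apply/andP; split.
  apply: leq_trans (size_sum _ _ _) _; apply/bigmax_leqP => k _.
  apply: leq_trans (size_sum _ _ _) _; apply/bigmax_leqP => l _.
  apply: leq_trans (sz_term _ _ _ (leqnn _)) _.
  by have := ltn_ord k; have := ltn_ord l; lia.
apply: leq_trans (size_sum _ _ _) _; apply/bigmax_leqP => l _.
apply: leq_trans (sz_term _ _ _ (leqnn _)) _.
by have := ltn_ord l; lia.
Qed.

(** [#|Fq|] is a power of the characteristic, which [f] transports to [L]. *)
Lemma expr_cardD (Fq : finFieldType) (L : fieldType) (f : {rmorphism Fq -> L})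
    (x y : L) : (x + y) ^+ #|Fq| = x ^+ #|Fq| + y ^+ #|Fq|.
Proof.
have := finField_is_abelem Fq; rewrite /is_abelem => /abelem_pgroup.
rewrite /pgroup cardsT => p_nat; have [n cardE] := p_natP p_nat.
have pr_p : prime (pdiv #|Fq|) by rewrite pdiv_prime // finNzRing_gt1.
have pFq := card_finPcharP cardE pr_p.
by apply: exprDn_pchar; rewrite (eq_pnat _ (pcharf_eq (rmorph_pchar f pFq))).
Qed.

Section TauEval.
Variables (K L : fieldType) (sigma : {rmorphism K -> L}) (q : nat).
Implicit Types (f g : {poly K}) (x y : L).
Notation ev := (tau_eval sigma q).

Lemma tau_eval_widen n f x : (size f <= n)%N ->
  ev f x = \sum_(j < n) sigma f`_j * x ^+ (q ^ j).
Proof.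
move=> fn; rewrite /tau_eval.
rewrite (big_ord_widen n (fun j => sigma f`_j * x ^+ (q ^ j)) fn) big_mkcond /=.
apply: eq_bigr => j _; case: ltnP => // fj.
by rewrite nth_default // rmorph0 mul0r.
Qed.

Lemma tau_eval0 x : ev 0 x = 0.
Proof. by rewrite /tau_eval size_poly0 big_ord0. Qed.

Lemma tau_evalD f g x : ev (f + g) x = ev f x + ev g x.
Proof.
pose n := maxn (size f) (size g).
rewrite !(@tau_eval_widen n) ?size_polyD ?leq_maxl ?leq_maxr // -big_split.
by apply: eq_bigr => j _; rewrite coefD rmorphD mulrDl.
Qed.

Lemma tau_eval_sum (I : Type) (s : seq I) (P : pred I) (F : I -> {poly K}) x :
  ev (\sum_(k <- s | P k) F k) x = \sum_(k <- s | P k) ev (F k) x.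
Proof.
by apply: (big_morph (fun f => ev f x)) => [f g|]; rewrite ?tau_evalD ?tau_eval0.
Qed.

Lemma tau_eval_monomial c k x : ev (c *: 'X^k) x = sigma c * x ^+ (q ^ k).
Proof.
rewrite (@tau_eval_widen k.+1) ?big_ord_recr /=; last first.
  by apply: leq_trans (size_scale_leq _ _) _; rewrite size_polyXn.
rewrite coefZ coefXn eqxx mulr1 big1 ?add0r // => j _.
by rewrite coefZ coefXn ltn_eqF ?mulr0 ?rmorph0 ?mul0r.
Qed.

Lemma tau_evalC c x : ev c%:P x = sigma c * x.
Proof.
by have := tau_eval_monomial c 0 x; rewrite expr0 alg_polyC expn0 expr1.
Qed.

Hypothesis frobD : forall x y : L, (x + y) ^+ q = x ^+ q + y ^+ q.

Hypothesis q_gt1 : (1 < q)%N.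

Lemma frob_iterD k x y : (x + y) ^+ (q ^ k) = x ^+ (q ^ k) + y ^+ (q ^ k).
Proof.
by elim: k => [|k IH]; rewrite ?expr1 // expnSr !exprM IH frobD.
Qed.

Lemma q_exp_gt0 k : (0 < q ^ k)%N.
Proof. by rewrite expn_gt0 ltnW. Qed.

Lemma tau_eval_arg0 f : ev f 0 = 0.
Proof. by apply: big1 => j _; rewrite expr0n gtn_eqF ?q_exp_gt0 // mulr0. Qed.

Lemma tau_eval_argD f x y : ev f (x + y) = ev f x + ev f y.
Proof.
by rewrite -big_split; apply: eq_bigr => j _; rewrite frob_iterD mulrDr.
Qed.

(** Additivity of the iterated Frobenius distributes the outer power over the inner sum. *)
Lemma tau_eval_skew_mul f g x : ev (skew_mul q f g) x = ev f (ev g x).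
Proof.
rewrite /skew_mul tau_eval_sum [RHS]/tau_eval; apply: eq_bigr => k _.
rewrite tau_eval_sum.
rewrite [tau_eval _ _ g x]/tau_eval.
have -> : (\sum_(j < size g) sigma g`_j * x ^+ (q ^ j)) ^+ (q ^ k) =
   \sum_(j < size g) (sigma g`_j * x ^+ (q ^ j)) ^+ (q ^ k).
  apply: (big_morph (fun z : L => z ^+ (q ^ k))); first exact: frob_iterD.
  by rewrite expr0n gtn_eqF ?q_exp_gt0.
rewrite mulr_sumr; apply: eq_bigr => j _.
by rewrite tau_eval_monomial rmorphM rmorphXn exprMn -exprM -expnD mulrA addnC.
Qed.

(** As [q > 1], the exponents [q ^ j] are distinct, so the leading coefficient of [f] survives. This
    will bound the number of zeros. *)
Lemma tau_eval_poly f : f != 0 ->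
  exists2 p : {poly L}, p != 0 & forall x, ev f x = p.[x].
Proof.
move=> f0; exists (\sum_(j < size f) sigma f`_j *: 'X^(q ^ j)); last first.
  by move=> x; rewrite horner_sum; apply: eq_bigr => j _; rewrite hornerZ hornerXn.
apply/eqP => /(congr1 (fun p : {poly L} => p`_(q ^ (size f).-1))).
rewrite coef0 coef_sum polySpred // big_ord_recr /= big1 => [|j _].
  rewrite add0r coefZ coefXn eqxx mulr1 => /eqP.
  by rewrite fmorph_eq0 -/(lead_coef f) lead_coef_eq0 (negPf f0).
by rewrite coefZ coefXn eqn_exp2l // gtn_eqF ?mulr0.
Qed.

End TauEval.

(** * Twisted polynomials on a small disc *)

Section TauEvalVal.
Variables (K L : fieldType) (sigma : {rmorphism K -> L}) (q : nat).
Variable w : L -> rat.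
Hypothesis w_val : is_valuation w.
Hypothesis q_gt1 : (1 < q)%N.

Lemma le_sum_norm (I : eqType) (s : seq I) (F : I -> rat) j :
  j \in s -> `|F j| <= \sum_(k <- s) `|F k|.
Proof.
move=> js; rewrite (big_rem j) //= lerDl.
by apply: sumr_ge0 => k _; apply: normr_ge0.
Qed.

(** A term [a * x ^+ N] with [N >= 2] has value above [w x] as soon as [w x] exceeds the absolute
    value of [w a]; summing these absolute values over all coefficients gives a uniform bound. *)
Lemma tau_eval_linear_part f : exists2 C : rat, 0 <= C &
  forall x, x != 0 -> C < w x ->
    val_gt w (w x) (tau_eval sigma q f x - sigma f`_0 * x).
Proof.
exists (\sum_(j <- iota 0 (size f).+1) `|w (sigma f`_j)|).
  by apply: sumr_ge0 => k _; apply: normr_ge0.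
(* Widening by one index lets the linear term be split off even when [f] is zero. *)
move=> x x0 Cx; rewrite (@tau_eval_widen _ _ _ _ (size f).+1) // big_ord_recl.
rewrite expn0 expr1 addrC addKr; apply: val_gt_sum => // j _.
rewrite lift0; set a := sigma _; set N := (q ^ j.+1)%N.
have [->|a0] := eqVneq a 0; first by rewrite mul0r; apply: val_gt0.
have aC : `|w a| < w x.
  apply: le_lt_trans Cx; apply: (@le_sum_norm _ _ (fun j => w (sigma f`_j))).
  by rewrite mem_iota add0n ltnS /= ltn_ord.
have N2 : (2 <= N)%N.
  by apply: leq_trans q_gt1 _; rewrite -[leqLHS]expn1 leq_exp2l.
rewrite /val_gt mulf_eq0 expf_eq0 (negPf a0) (negPf x0) andbF /=.
rewrite valM ?expf_neq0 // valX //.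
have wx0 : 0 < w x by apply: le_lt_trans aC.
have : w x *+ 2 <= w x *+ N by rewrite ler_wpMn2l ?ltW.
move: aC; rewrite ltr_norml mulr2n => /andP[h1 h2]; lra.
Qed.
End TauEvalVal.

Lemma tau_eval_no_small_root (K : fieldType) (L : closedFieldType)
    (sigma : {rmorphism K -> L}) (q : nat) (w : L -> rat) (f : {poly K}) :
  (1 < q)%N -> f != 0 ->
  exists2 C : rat, 0 <= C & forall x, C < w x -> tau_eval sigma q f x != 0.
Proof.
move=> q_gt1 f0; have [p p0 pE] := tau_eval_poly sigma q_gt1 f0.
have [r rE] := closed_field_poly_normal p.
(* The bound dominates the value of each of the finitely many zeros. The zero at [0] is among them,
   so its arbitrary stored value is covered too. *)
exists (\sum_(z <- r) `|w z|); first by apply: sumr_ge0 => z _; apply: normr_ge0.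
move=> x Cx; rewrite pE -/(root p x) rE rootZ ?lead_coef_eq0 // root_prod_XsubC.
apply/negP => /(le_sum_norm (fun z => w z)) h.
by have := lt_le_trans Cx (le_trans (ler_norm _) h); rewrite ltxx.
Qed.

(** * Drinfeld modules: constants and degrees in tau *)

Section Drinfeld.
Variables (Fq : finFieldType) (A : comNzRingType) (K : fieldType).
Variables (i : {rmorphism A -> K}) (phi : A -> {poly K}).
Variable cst : {rmorphism Fq -> A}.
Hypothesis phi_drinfeld : is_drinfeld_module #|Fq| i phi.

Let q_gt1 : (1 < #|Fq|)%N := finNzRing_gt1 Fq.

Lemma drinfeld1 : phi 1 = 1. Proof. by case: phi_drinfeld. Qed.

Lemma drinfeldD a b : phi (a + b) = phi a + phi b.
Proof. by case: phi_drinfeld. Qed.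

Lemma drinfeldM a b : phi (a * b) = skew_mul #|Fq| (phi a) (phi b).
Proof. by case: phi_drinfeld. Qed.

Lemma drinfeld_coef0 a : (phi a)`_0 = i a.
Proof. by case: phi_drinfeld. Qed.

Lemma drinfeld0 : phi 0 = 0.
Proof. by apply: (@addrI _ (phi 0)); rewrite -drinfeldD !addr0. Qed.

Lemma size_drinfeldM a b : phi a != 0 -> phi b != 0 ->
  size (phi (a * b)) = (size (phi a) + size (phi b)).-1.
Proof. by move=> a0 b0; rewrite drinfeldM size_skew_mul. Qed.

Lemma drinfeld_cst_neq0 c : c != 0 -> phi (cst c) != 0.
Proof.
move=> c0; apply/eqP => h.
have := drinfeld1; rewrite -(rmorph1 cst) -(divff c0) rmorphM drinfeldM h.
by rewrite /skew_mul size_poly0 big_ord0 => /eqP; rewrite eq_sym oner_eq0.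
Qed.

(** A nonzero [c] satisfies [c ^+ #|Fq|.-1 = 1] and degrees in tau are additive, so a positive
    multiple of the degree of [phi (cst c)] is 0. *)
Lemma drinfeld_cst c : phi (cst c) = (i (cst c))%:P.
Proof.
have [->|c0] := eqVneq c 0; first by rewrite !rmorph0 drinfeld0.
suff : (size (phi (cst c)) <= 1)%N by move=> /size1_polyC; rewrite drinfeld_coef0.
have phic0 := drinfeld_cst_neq0 c0.
have sz n : phi (cst c ^+ n) != 0 /\
    (size (phi (cst c ^+ n)) = n * (size (phi (cst c))).-1 + 1)%N.
  elim: n => [|n [n0 IH]]; first by rewrite drinfeld1 oner_eq0 size_poly1.
  have := size_drinfeldM phic0 n0; rewrite -exprS -size_poly_gt0 IH => ->.
  by move: phic0; rewrite -size_poly_gt0; lia.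
have [_] := sz #|Fq|.-1; rewrite -rmorphXn.
have -> : c ^+ #|Fq|.-1 = 1.
  by apply: (mulfI c0); rewrite -exprS prednK ?expf_card ?mulr1 // ltnW.
rewrite rmorph1 drinfeld1 size_poly1.
have : (0 < #|Fq|.-1)%N by rewrite -ltnS prednK // ltnW.
move: (#|Fq|.-1) => n; nia.
Qed.

(** Each Horner step multiplies by [t], whose image has positive degree in tau, then adds a
    constant, which cannot cancel the top term. *)
Lemma drinfeld_evp_neq0 t p : (1 < size (phi t))%N -> p != 0 ->
  phi (evp cst t p) != 0.
Proof.
move=> t_gt1; elim/poly_ind: p => [|p c IH]; first by rewrite eqxx.
rewrite rmorphD rmorphM evpX evpC drinfeldD => pc0.
have [p0|p0] := eqVneq p 0.
  move: pc0; rewrite p0 mul0r add0r polyC_eq0 rmorph0 mul0r drinfeld0 add0r.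
  exact: drinfeld_cst_neq0.
rewrite drinfeld_cst.
have t0 : phi t != 0 by rewrite -size_poly_gt0 ltnW.
have sz := size_drinfeldM (IH p0) t0; move: (IH p0); rewrite -size_poly_gt0 => sz_p.
rewrite -size_poly_gt0 size_polyDl sz; first by move: sz_p t_gt1; lia.
by apply: leq_ltn_trans (size_polyC_leq1 _) _; move: sz_p t_gt1; lia.
Qed.

End Drinfeld.

(** * Bounds on nonzero torsion points *)

Section Torsion.
Variables (Fq : finFieldType) (A : comNzRingType) (K : fieldType).
Variables (i : {rmorphism A -> K}) (phi : A -> {poly K}).
Variable cst : {rmorphism Fq -> A}.
Hypothesis phi_drinfeld : is_drinfeld_module #|Fq| i phi.
Variables (L : closedFieldType) (sigma : {rmorphism K -> L}) (w : L -> rat).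
Hypothesis w_val : is_valuation w.
Hypothesis divides : forall s b : A, b != 0 ->
  exists2 c, c != 0 & exists b', evp cst s c = b * b'.

Let q_gt1 : (1 < #|Fq|)%N := finNzRing_gt1 Fq.
Let frobD : forall x y : L, (x + y) ^+ #|Fq| = x ^+ #|Fq| + y ^+ #|Fq| :=
  expr_cardD (sigma \o i \o cst).

Definition drinfeld_act (a : A) (x : L) := tau_eval sigma #|Fq| (phi a) x.

Local Notation E := drinfeld_act.

Lemma drinfeld_actD a b x : E (a + b) x = E a x + E b x.
Proof. by rewrite /E (drinfeldD phi_drinfeld) tau_evalD. Qed.

Lemma drinfeld_actM a b x : E (a * b) x = E a (E b x).
Proof. by rewrite /E (drinfeldM phi_drinfeld) tau_eval_skew_mul. Qed.

Lemma drinfeld_act_argD a x y : E a (x + y) = E a x + E a y.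
Proof. exact: tau_eval_argD. Qed.

Lemma drinfeld_act_arg0 a : E a 0 = 0.
Proof. exact: tau_eval_arg0. Qed.

Lemma drinfeld_act_argN a x : E a (- x) = - E a x.
Proof. by apply: (addrI (E a x)); rewrite -drinfeld_act_argD !subrr drinfeld_act_arg0. Qed.

Lemma drinfeld_act0 x : E 0 x = 0.
Proof. by rewrite /E (drinfeld0 phi_drinfeld) tau_eval0. Qed.

Lemma drinfeld_act_cst c x : E (cst c) x = sigma (i (cst c)) * x.
Proof. by rewrite /E (drinfeld_cst cst phi_drinfeld) tau_evalC. Qed.

(** The Horner recursion behind the two torsion bounds below. *)
Lemma drinfeld_act_evp_cons t p c x :
  E (evp cst t (p * 'X + c%:P)) x =
  E (evp cst t p) (E t x) + sigma (i (cst c)) * x.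
Proof. by rewrite rmorphD rmorphM evpX evpC drinfeld_actD drinfeld_actM
  drinfeld_act_cst. Qed.

Lemma is_torsionB x y : (forall a b : A, a != 0 -> b != 0 -> a * b != 0) ->
  is_torsion sigma #|Fq| phi x -> is_torsion sigma #|Fq| phi y ->
  is_torsion sigma #|Fq| phi (x - y).
Proof.
move=> A_dom [a [a0 ax]] [b [b0 bx]]; exists (a * b); split; first exact: A_dom.
have abx : E (a * b) x = 0 by rewrite mulrC drinfeld_actM [E a x]ax drinfeld_act_arg0.
have aby : E (a * b) y = 0 by rewrite drinfeld_actM [E b y]bx drinfeld_act_arg0.
by rewrite -/(E _ _) drinfeld_act_argD drinfeld_act_argN abx aby subrr.
Qed.

(** A point killed by [b] is killed by every multiple of [b], among them a nonzero polynomial in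
    [s]. *)
Lemma torsion_evp_neq0 s C :
  (forall f x, f != 0 -> x != 0 -> C < w x -> E (evp cst s f) x != 0) ->
  forall x, x != 0 -> is_torsion sigma #|Fq| phi x -> w x <= C.
Proof.
move=> h x x0 [b [b0 bx]]; rewrite leNgt; apply/negP => Cx.
have [c c0 [b' cE]] := divides s b0; have := h c x c0 x0 Cx.
by rewrite cE mulrC drinfeld_actM [E b x]bx drinfeld_act_arg0 eqxx.
Qed.

Lemma val_cst c : c != 0 -> w (sigma (i (cst c))) = 0.
Proof. exact: (@val_finField _ _ _ w (sigma \o i \o cst)). Qed.

Lemma val_gt_mul_cst r c x : val_gt w r x -> val_gt w r (sigma (i (cst c)) * x).
Proof.
apply: val_ge_gtM => //; have [->|c0] := eqVneq c 0.
  by rewrite !rmorph0 val_ge0.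
by rewrite /val_ge val_cst // lexx orbT.
Qed.

Lemma torsion_bound_positive s : s != 0 -> phi s != 0 ->
  val_gt w 0 (sigma (i s)) ->
  exists C, forall x, x != 0 -> is_torsion sigma #|Fq| phi x -> w x <= C.
Proof.
move=> s0 phis0 s_gt.
have [C1 C1_ge lin] := tau_eval_linear_part sigma w_val q_gt1 (phi s).
have [C2 C2_ge noroot] := tau_eval_no_small_root sigma w q_gt1 phis0.
(* [C1] makes the nonlinear part of [phi s] raise values; [C2] keeps its nonzero zeros out of the
   disc. *)
pose C := Num.max C1 C2.
have Es_gt y : y != 0 -> C < w y -> val_gt w (w y) (E s y).
  move=> y0; rewrite gt_max => /andP[C1y C2y].
  rewrite -(subrK (sigma (i s) * y) (E s y)); apply: val_gtD => //.
    by rewrite -(drinfeld_coef0 phi_drinfeld s); apply: lin.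
  move: s_gt; rewrite /val_gt mulf_eq0 (negPf y0) orbF.
  by case: eqVneq => //= is0; rewrite valM // => ?; rewrite ltrDr.
(* Discs beyond [C] are stable under all polynomials in [s]: constants do not lower values and [s]
   raises them. *)
have Eg_gt g r z : C <= r -> val_gt w r z -> val_gt w r (E (evp cst s g) z).
  elim/poly_ind: g z => [|g c IH] z Cr rz; first by rewrite rmorph0 drinfeld_act0 val_gt0.
  rewrite drinfeld_act_evp_cons; apply: val_gtD => //; last exact: val_gt_mul_cst.
  apply: IH => //; have [->|z0] := eqVneq z 0; first by rewrite drinfeld_act_arg0 val_gt0.
  move: rz; rewrite /val_gt (negPf z0) /= => rz.
  by apply: (val_gt_le (ltW rz)); apply: Es_gt => //; apply: le_lt_trans rz.
exists C; apply: (torsion_evp_neq0 (s := s)) => f y.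
elim/poly_ind: f y => [|g c IH] y; first by rewrite eqxx.
have [->|c0] := eqVneq c 0.
  (* A zero constant coefficient is factored out: [y] is replaced by [E s y], which is nonzero and
     again in the disc. *)
  rewrite addr0 => gX0 y0 Cy; rewrite rmorphM evpX drinfeld_actM.
  have [_ C2y] : C1 < w y /\ C2 < w y by apply/andP; rewrite -gt_max.
  have Esy0 : E s y != 0 by apply: noroot.
  apply: IH => //; first by apply: contra gX0 => /eqP ->; rewrite mul0r.
  by have := Es_gt _ y0 Cy; rewrite /val_gt (negPf Esy0) /=; apply: lt_trans.
(* Otherwise the constant term has value exactly [w y], and the rest, a polynomial in [s] acting on
   [E s y], has larger value. *)
move=> _ y0 Cy; rewrite drinfeld_act_evp_cons addrC.
have ic0 : sigma (i (cst c)) != 0 by rewrite -[sigma _]/((sigma \o i \o cst) c) fmorph_eq0.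
apply: val_gt_addr w_val _ _ _ _; first by rewrite mulf_neq0.
by rewrite valM // val_cst // add0r; apply: Eg_gt; [exact: ltW|exact: Es_gt].
Qed.

(** The hypothesis says that the residue of [i t] is transcendental over [Fq]. One constant, taken
    from [phi t] alone, serves all [f], since error terms stay in the disc where they arise. *)
Lemma torsion_bound_residually_transcendental t :
  (forall f, f != 0 -> sigma (i (evp cst t f)) != 0 /\
                       w (sigma (i (evp cst t f))) = 0) ->
  exists C, forall x, x != 0 -> is_torsion sigma #|Fq| phi x -> w x <= C.
Proof.
move=> t_unit.
have [C C_ge lin] := tau_eval_linear_part sigma w_val q_gt1 (phi t).
have it_ge f : val_ge w 0 (sigma (i (evp cst t f))).
  have [->|f0] := eqVneq f 0; first by rewrite !rmorph0 val_ge0.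
  by rewrite /val_ge (t_unit f f0).2 lexx orbT.
have it_unit := t_unit 'X; rewrite polyX_eq0 evpX in it_unit.
have {it_unit} [it0 wit] := it_unit isT.
have Ef_gt f x : x != 0 -> C < w x ->
    val_gt w (w x) (E (evp cst t f) x - sigma (i (evp cst t f)) * x).
  elim/poly_ind: f x => [|g c IH] x x0 Cx.
    by rewrite !rmorph0 drinfeld_act0 mul0r subrr val_gt0.
  have IH' r : val_gt w (w x) r -> val_gt w (w x) (E (evp cst t g) r).
    have [->|r0] := eqVneq r 0; first by rewrite drinfeld_act_arg0.
    move=> rx; rewrite -(subrK (sigma (i (evp cst t g)) * r) (E _ r)).
    apply: val_gtD => //; last exact: val_ge_gtM.
    move: rx; rewrite /val_gt (negPf r0) /= => rx.
    by apply: (val_gt_le (ltW rx)); apply: IH => //; apply: lt_trans rx.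
  (* Additivity splits the action on [E t x] into that on the linear part, treated by induction
     because [i t] has value 0, and that on the nonlinear part [r]; the terms with [c] cancel. *)
  pose r := E t x - sigma (i t) * x.
  have rx : val_gt w (w x) r by rewrite /r -(drinfeld_coef0 phi_drinfeld t); apply: lin.
  have -> : E (evp cst t (g * 'X + c%:P)) x - sigma (i (evp cst t (g * 'X + c%:P))) * x =
     (E (evp cst t g) (sigma (i t) * x) - sigma (i (evp cst t g)) * (sigma (i t) * x))
     + E (evp cst t g) r.
    rewrite drinfeld_act_evp_cons rmorphD rmorphM evpX evpC !rmorphD !rmorphM.
    rewrite -[E t x](subrK (sigma (i t) * x)) -/r drinfeld_act_argD.
    by rewrite /=; ring.
  apply: val_gtD => //; last exact: IH'.
  have wE : w (sigma (i t) * x) = w x by rewrite valM // wit add0r.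
  by rewrite -{1}wE; apply: IH; rewrite ?mulf_neq0 // wE.
exists C; apply: (torsion_evp_neq0 (s := t)) => f x f0 x0 Cx.
have [if0 wif] := t_unit f f0.
rewrite -(subrK (sigma (i (evp cst t f)) * x) (E _ x)) addrC.
apply: val_gt_addr w_val _ _ _ _; first by rewrite mulf_neq0.
by rewrite valM // wif add0r; apply: Ef_gt.
Qed.

End Torsion.

(** * From isolated torsion to the bound on lambda *)

Lemma val_ge_evp (k R : comNzRingType) (f : {rmorphism k -> R}) (L : fieldType)
    (h : {rmorphism R -> L}) (w : L -> rat) (t : R) (p : {poly k}) :
  is_valuation w -> (forall c, val_ge w 0 (h (f c))) -> val_ge w 0 (h t) ->
  val_ge w 0 (h (evp f t p)).
Proof.
move=> w_val c_ge t_ge; elim/poly_ind: p => [|p c IH].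
  by rewrite !rmorph0 val_ge0.
by rewrite rmorphD rmorphM evpX evpC rmorphD rmorphM val_geD // val_geM.
Qed.

(* Two torsion points near [z] differ by a torsion point near [0]. *)
Lemma isolated_translate (L : fieldType) (w : L -> rat) (T : L -> Prop) (z : L) :
  is_valuation w -> (forall x y, T x -> T y -> T (x - y)) ->
  (exists C, forall x, x != 0 -> T x -> w x <= C) ->
  exists C, forall x, T x -> x != z -> w (x - z) <= C.
Proof.
move=> w_val T_sub [C hC].
have [[y [Ty [yz yC]]]|far] :=
  classic (exists y, T y /\ y != z /\ C < w (y - z)); last first.
  exists C => x Tx xz; rewrite leNgt; apply/negP => h; apply: far; by exists x.
(* A point closer to [z] than [y] would differ from [y] by a nonzero element of [T] of value above
   [C]. *)
exists (w (y - z)) => x Tx xz; have [->//|xy] := eqVneq x y.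
rewrite leNgt; apply/negP => lt.
have := hC (x - y); rewrite subr_eq0 => /(_ xy (T_sub _ _ Tx Ty)).
have : val_gt w C (x - y).
  have -> : x - y = (x - z) - (y - z) by ring.
  apply: val_gtB => //; rewrite /val_gt ?yC ?orbT //.
  by rewrite (lt_trans yC lt) orbT.
by rewrite /val_gt subr_eq0 (negPf xy) /= leNgt => ->.
Qed.

(** The witness is a multiple of [X_k - Q_k] scaled to be integral; the final 1 makes the inequality
    strict. *)
Lemma lambda_lt_of_coordinate (L : fieldType) (w : L -> rat) (g : nat)
    (P Q : 'I_g -> L) (k : 'I_g) (C : rat) :
  is_valuation w -> P k != Q k -> w (P k - Q k) <= C ->
  lambda_lt w P Q (C + `|w (Q k)| + 1).
Proof.
move=> w_val PQ wPQ.
suff [c [c0 c_ge cQ_ge wc]] : exists c : L,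
    [/\ c != 0, val_ge w 0 c, val_ge w 0 (c * Q k) & w c <= `|w (Q k)|].
  have fE z : (c *: 'X_k - (c * Q k)%:MP : {mpoly L[g]}).@[z] = c * (z k - Q k).
    by rewrite mevalB mevalZ mevalXU mevalC mulrBr.
  have PQ0 : P k - Q k != 0 by rewrite subr_eq0.
  exists (c *: 'X_k - (c * Q k)%:MP); split.
  - by rewrite /in_vanishing_ideal fE subrr mulr0.
  - move=> m m0; suff : val_ge w 0 (mcoeff m (c *: 'X_k - (c * Q k)%:MP)).
      by rewrite /val_ge (negPf m0).
    have nat_ge (b : bool) : val_ge w 0 b%:R.
      by case: b; rewrite ?val_ge0 // /val_ge val1 // lexx orbT.
    rewrite mcoeffB mcoeffZ mcoeffX mcoeffC -mulNr.
    apply: val_geD => //; apply: val_geM => //.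
    by rewrite /val_ge oppr_eq0 valN.
  - by rewrite fE mulf_neq0.
  - by rewrite fE valM //; lra.
(* The scale is [1] when [Q k] is integral and its inverse otherwise. *)
have [Q_ge|] := boolP (val_ge w 0 (Q k)).
  exists 1; rewrite oner_neq0 mul1r val1 // normr_ge0; split=> //.
  by rewrite /val_ge val1 // lexx orbT.
rewrite negb_or => /andP[Q0]; rewrite -ltNge => Q_lt; exists (Q k)^-1.
rewrite invr_eq0 mulVf // valV // ltr0_norm // lexx; split=> //.
  by rewrite /val_ge valV // oppr_ge0 ltW ?orbT.
by rewrite /val_ge val1 // lexx orbT.
Qed.

Theorem theorem2p9
  (Fq : finFieldType) (F : fieldType) (kappa : {rmorphism Fq -> F})
  (winf : F -> int)
  (A : comNzRingType) (iota : {rmorphism A -> F})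
  (K : fieldType) (i : {rmorphism A -> K}) (phi : A -> {poly K})
  (v : K -> int)
  (L : closedFieldType) (sigma : {rmorphism K -> L}) (w : L -> rat)
  (g : nat) :
  is_function_field kappa ->
  is_place kappa winf ->
  injective iota ->
  (forall x : F, (exists a, iota a = x) <-> regular_away kappa winf x) ->
  is_drinfeld_module #|Fq| i phi ->
  is_normalized_dval v ->
  (injective i -> forall j : {rmorphism F -> K},
      (forall a, j (iota a) = i a) -> ~ lies_over v j winf) ->
  is_alg_closure_of_completion v sigma w ->
  (0 < g)%N ->
  forall Q : 'I_g -> L, exists C : rat, 0 < C /\
    forall P : 'I_g -> L, (forall k, is_torsion sigma #|Fq| phi (P k)) ->
      P = Q \/ lambda_lt w P Q C.
Proof.
move=> F_ff winf_place iota_inj A_reg phi_dr [v_val _] not_over [w_val w_ext _] _ Q.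
have [cst cstE] := coord_ring_constants iota_inj A_reg.
have divides := coord_ring_divides F_ff iota_inj cstE.
have A_dom (a b : A) : a != 0 -> b != 0 -> a * b != 0.
  by move=> a0 b0; rewrite (coord_ring_mulf_eq0 iota_inj) negb_or a0.
(* A [phi t] of size at most 1 would equal its constant coefficient [i t]; nontriviality supplies a
   [t] where this fails. *)
have [t t_gt1] : exists t, (1 < size (phi t))%N.
  case: (phi_dr) => _ _ _ coef0 [t t_ne]; exists t; rewrite ltnNge.
  by apply: contra t_ne => /size1_polyC {1}->; rewrite coef0.
have t_tr p : p != 0 -> phi (evp cst t p) != 0.
  move=> p0; exact: (drinfeld_evp_neq0 cst phi_dr t_gt1 p0).
have phi_inj a : a != 0 -> phi a != 0.
  move=> a0; have [c c0 [b cE]] := divides t a a0; have := t_tr c c0.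
  apply: contra => /eqP h.
  by rewrite cE (drinfeldM phi_dr) h /skew_mul size_poly0 big_ord0.
have tA p : p != 0 -> evp cst t p != 0.
  by move=> /t_tr; apply: contra => /eqP ->; rewrite (drinfeld0 phi_dr).
have bound : exists C, forall x, x != 0 ->
    is_torsion sigma #|Fq| phi x -> w x <= C.
  have [[s [s0 s_gt]]|none] :=
    classic (exists s, s != 0 /\ val_gt w 0 (sigma (i s))).
    exact: (torsion_bound_positive phi_dr w_val divides s0 (phi_inj s s0) s_gt).
  have i_le s : s != 0 -> sigma (i s) != 0 /\ w (sigma (i s)) <= 0.
    move=> s0; have : ~~ val_gt w 0 (sigma (i s)).
      by apply/negP => h; apply: none; exists s.
    by rewrite /val_gt negb_or -leNgt => /andP.
  have t0 : t != 0 by have := tA 'X; rewrite evpX polyX_eq0; apply.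
  have [it0 wit_le] := i_le t t0.
  (* A nonzero element of the kernel would fall under the first case, since [val_gt] admits [0]. *)
  have i_inj : injective i.
    move=> a b ab; apply/eqP; rewrite -subr_eq0; apply/negPn/negP => /i_le[].
    by rewrite rmorphB ab subrr rmorph0 eqxx.
  have [vt_lt|vt_ge] := ltP (v (i t)) 0.
    have [j [jE over]] := coord_ring_lies_over F_ff iota_inj A_reg cstE v_val i_inj tA vt_lt.
    by case: (not_over i_inj j jE).
  apply: (torsion_bound_residually_transcendental phi_dr w_val divides (t := t)).
  move=> f f0; have [if0 wif_le] := i_le _ (tA f f0); split=> //.
  apply/eqP; rewrite eq_le wif_le /=.
  (* Integrality of [i t] passes to polynomials in [t]; the opposite inequality holds on all nonzero
     elements of [A] in this case. *)
  have : val_ge w 0 ((sigma \o i) (evp cst t f)).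
    apply: val_ge_evp => // [c|].
      have [->|c0] := eqVneq c 0; first by rewrite !rmorph0 val_ge0.
      by rewrite /val_ge /= val_cst // lexx orbT.
    rewrite /val_ge /= w_ext ?ler0z ?vt_ge ?orbT //.
    by move: it0; rewrite fmorph_eq0.
  by rewrite /val_ge /= (negPf if0).
have /fin_all_exists[C hC] : forall k, exists C, forall x,
    is_torsion sigma #|Fq| phi x -> x != Q k -> w (x - Q k) <= C.
  move=> k; apply: isolated_translate w_val _ bound => x y.
  exact: (is_torsionB cst phi_dr A_dom).
(* Absolute values make each [B k] nonnegative, so the sum dominates the bound at whichever
   coordinate separates [P] from [Q]. *)
pose B k := `|C k| + `|w (Q k)| + 1.
have B0 k : 0 <= B k by rewrite /B !addr_ge0.
exists (\sum_k B k + 1); split; first by apply: ltr_wpDl; rewrite ?sumr_ge0.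
move=> P P_tor; have [all_eq|] := boolP [forall k, P k == Q k].
  by left; apply: functional_extensionality => k; apply/eqP/(forallP all_eq).
rewrite negb_forall => /existsP[k PQk]; right.
have [f [fQ f_int fP0 wf]] := lambda_lt_of_coordinate w_val PQk (hC k _ (P_tor k) PQk).
exists f; split=> //; apply: lt_le_trans wf _.
rewrite (bigD1 k) //= /B; have := ler_norm (C k).
have : 0 <= \sum_(j < g | j != k) B j by apply: sumr_ge0.
rewrite /B; lra.
Qed.
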